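(* Let $N\ge 1$ be an integer. Let $\{\mathcal{X}_i\}_{i=1}^N$ be a sequence of finite sets with $|\mathcal{X}_1|=1$, let $\{G_i\}_{i=1}^N$ be a sequence of finite groups with $G_1$ the trivial group, such that for each $1\le i\le N$ the group $G_i$ acts on the set $\mathcal{X}_i$, and let $\{\phi_i\}_{i=1}^{N-1}$ be a sequence of maps such that $\phi_i:\mathcal{X}_{i+1}\to\mathcal{X}_i$ is surjective for each $1\le i\le N-1$. Suppose that $1\le i\le N-1$, and let $T_{i+1}$ be a random element of $\mathcal{X}_{i+1}$ such that $$\mathbb{P}(T_{i+1}=x)=\frac{1}{k(\mathcal{X}_{i+1},G_{i+1})}\cdot\frac{1}{|O_{i+1}(x)|},\qquad\text{for all }x\in\mathcal{X}_{i+1}.$$ Then $$\frac{|G_{i+1}|}{|G_i|}\cdot\mathbb{E}\left[\frac{|Stab_i(\phi_i(T_{i+1}))|}{|Stab_{i+1}(T_{i+1})|\,|\phi_i^{-1}(\phi_i(T_{i+1}))|}\right]=\frac{k(\mathcal{X}_i,G_i)}{k(\mathcal{X}_{i+1},G_{i+1})}.$$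
   Context: For $1\le i\le N$ and $x\in\mathcal{X}_i$, $O_i(x)$ denotes the orbit of $x$ in $\mathcal{X}_i$ under the action of $G_i$, and $Stab_i(x)$ denotes the stabilizer of $x$ in $G_i$. The number of orbits of $\mathcal{X}_i$ under the action of $G_i$ is denoted by $k(\mathcal{X}_i,G_i)$. For $y\in\mathcal{X}_i$, $\phi_i^{-1}(y)=\{x\in\mathcal{X}_{i+1}:\phi_i(x)=y\}$ is the preimage of $y$. No compatibility between the maps $\phi_i$ and the group actions is assumed. *)

(* Defs.v *)
From HB Require Import structures.
From mathcomp Require Import all_boot all_order all_algebra all_fingroup.
From mathcomp Require Import all_classical all_reals all_analysis.

Set Implicit Arguments.
Unset Strict Implicit.
Unset Printing Implicit Defensive.

Section Orbits.
Variables (gT : finGroupType) (G : {group gT}) (rT : finType).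

(* MathComp actions are right actions; a left action [g . x] is represented by
   [to x g := g^-1 . x], which has the same orbits and the same stabilizers. *)
Definition num_orbits (to : action G rT) : nat :=
  #|orbit to G @: [set: rT]%SET|.

End Orbits.

(* [X] carries the discrete sigma-algebra, in which every subset is
   measurable. *)
Definition random_element (d : measure_display) (Om : measurableType d)
    (X : finType) (T : Om -> X) : Prop :=
  forall A : set X, measurable (T @^-1` A)%classic.

(* Main.v *)
(* By orbit-stabilizer, |G_{i+1}| / |Stab_{i+1}(x)| = |O_{i+1}(x)|, which cancels
   the weight 1/|O_{i+1}(x)| in the law of T_{i+1}; likewise |Stab_i(y)| / |G_i|
   = 1/|O_i(y)|. Up to the factor 1/k(X_{i+1}, G_{i+1}), what remains is the sum
   over x of 1/|O_i(phi_i(x))| averaged over the fibres of phi_i, that is, the sum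
   of 1/|O_i(y)| over all y in X_i, and this counts each orbit exactly once. *)

Require Import Defs.
From HB Require Import structures.
From mathcomp Require Import all_boot all_order all_algebra all_fingroup.
From mathcomp Require Import all_classical all_reals all_analysis.
From mathcomp Require Import measurable_realfun ring.

Set Implicit Arguments.
Unset Strict Implicit.
Unset Printing Implicit Defensive.

Import Order.TTheory GRing.Theory Num.Theory.

Local Open Scope ring_scope.

Lemma card_orbit_neq0 (F : numFieldType) (gT : finGroupType)
    (G : {group gT}) (rT : finType) (to : action G rT) (x : rT) :
  #|orbit to G x|%:R != 0 :> F.
Proof.
rewrite pnatr_eq0 -lt0n; apply/card_gt0P; exists x; exact: orbit_refl.
Qed.

(** Grouping the points by orbit, an orbit [O] contributes [#|O|] equal terms [1/#|O|], that is,
    exactly 1. *)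
Lemma sum_orbit_size_inv (F : numFieldType) (gT : finGroupType)
    (G : {group gT}) (rT : finType) (to : action G rT) :
  \sum_x (#|orbit to G x|%:R)^-1 = (num_orbits to)%:R :> F.
Proof.
rewrite (partition_big (fun x => orbit to G x)
  (mem (orbit to G @: [set: rT])%SET)) /=; last by move=> x _; exact: imset_f.
rewrite /num_orbits -sum1_card natr_sum; apply: eq_bigr => _ /imsetP[x _ ->].
rewrite (eq_bigr (fun=> (#|orbit to G x|%:R)^-1)); last first.
  by move=> y /eqP->.
rewrite (eq_bigl (mem (orbit to G x))); last first.
  move=> y; apply/eqP/idP => [<-|].
    exact: orbit_refl.
  by move/orbit_in_eqP; apply.
by rewrite sumr_const -[LHS]mulr_natl divff // card_orbit_neq0.
Qed.

(** The fibre over [y] consists of [n] points, each contributing [g y / n]. Surjectivity gives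
    [n != 0]; an empty fibre would contribute 0 instead of [g y]. *)
Lemma sum_fiber_average (F : numFieldType) (A B : finType) (f : A -> B)
    (g : B -> F) :
  (forall y, exists x, f x = y) ->
  \sum_x g (f x) / #|(f @^-1: [set f x])%SET|%:R = \sum_y g y.
Proof.
move=> f_surj; rewrite (partition_big f xpredT) //=; apply: eq_bigr => y _.
rewrite (eq_bigr (fun=> g y / #|(f @^-1: [set y])%SET|%:R)); last first.
  by move=> x /eqP->.
rewrite (eq_bigl (mem (f @^-1: [set y])%SET)); last by move=> x; rewrite !inE.
rewrite sumr_const -[LHS]mulr_natr divfK // pnatr_eq0 -lt0n.
have [x fxy] := f_surj y.
by apply/card_gt0P; exists x; rewrite !inE fxy.
Qed.

(** Since [X] is finite, [f (T w)] is a finite combination of indicators of the events [T = x].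
    Nonnegativity of [f] lets the integral pass through the sum and the scalars with measurability
    alone. *)
Lemma expectation_finite_law (R : realType) (d : measure_display)
    (Om : measurableType d) (P : probability Om R) (X : finType)
    (T : Om -> X) (f : X -> R) :
  random_element T -> (forall x, 0 <= f x) ->
  ('E_P[fun w => f (T w)] =
   \sum_x (f x)%:E * P (T @^-1` [set x])%classic)%E.
Proof.
move=> mT f_ge0; rewrite unlock.
pose h x w : R := \1_(T @^-1` [set x])%classic w.
have mh x : measurable_fun setT (fun w => (h x w)%:E).
  by apply/measurable_EFinP; apply: measurable_indic; exact: mT.
have -> : (fun w => (f (T w))%:E) =
    (fun w => \sum_x (f x)%:E * (h x w)%:E)%E.
  (* At a given [w], only the term [x = T w] survives. *)
  apply/funext => w; rewrite (bigD1 (T w)) //= big1 ?adde0.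
    by rewrite /h indicE mem_set // mule1.
  move=> x /eqP xT; rewrite /h indicE memNset ?mule0 //= => Tx.
  by apply: xT; rewrite Tx.
rewrite ge0_integral_sum //=; first 1 last.
- by move=> x; exact: measurable_funeM.
- by move=> x w _; rewrite -EFinM lee_fin mulr_ge0 // /h indicE.
apply: eq_bigr => x _; rewrite ge0_integralZl_EFin //.
  by rewrite integral_indic // ?setIT //; exact: mT.
by move=> w _; rewrite lee_fin /h indicE.
Qed.

(** Orbit-stabilizer, solved for the stabilizer so that both stabilizers in the expectation can be
    rewritten through orbit sizes. *)
Lemma card_stab_orbit (F : numFieldType) (gT : finGroupType) (G : {group gT})
    (rT : finType) (to : action G rT) (x : rT) :
  #|'C_G[x | to]%g|%:R = #|G|%:R * (#|orbit to G x|%:R)^-1 :> F.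
Proof.
rewrite -(card_orbit_in_stab to x (subxx G)) natrM mulrAC divff ?mul1r //.
exact: card_orbit_neq0.
Qed.

Theorem proposition3p1 (R : realType) (N : nat) (hN : (1 <= N)%N)
    (X : nat -> finType) (hX1 : #|X 1%N| = 1%N)
    (gT : nat -> finGroupType) (G : forall i : nat, {group gT i})
    (hG1 : G 1%N = 1%G)
    (to : forall i : nat, action (G i) (X i))
    (phi : forall i : nat, (1 <= i < N)%N -> X i.+1 -> X i)
    (hphi : forall (i : nat) (hi : (1 <= i < N)%N) (y : X i),
       exists x : X i.+1, phi i hi x = y)
    (i : nat) (hi : (1 <= i < N)%N)
    (d : measure_display) (Om : measurableType d) (P : probability Om R)
    (T : Om -> X i.+1) (hT : random_element T)
    (hlaw : forall x : X i.+1,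
       P (T @^-1` [set x])%classic =
       (((num_orbits (to i.+1))%:R)^-1 *
        (#|orbit (to i.+1) (G i.+1) x|%:R)^-1)%:E) :
  ((#|G i.+1|%:R / #|G i|%:R)%:E *
     'E_P[fun w =>
        (#|'C_(G i)[phi i hi (T w) | to i]%g|%:R /
        (#|'C_(G i.+1)[T w | to i.+1]%g|%:R *
         #|(phi i hi @^-1: [set phi i hi (T w)])%SET|%:R))%R])%E =
  ((num_orbits (to i))%:R / (num_orbits (to i.+1))%:R)%:E.
Proof.
rewrite (expectation_finite_law (f := fun x =>
  #|'C_(G i)[phi i hi x | to i]%g|%:R /
  (#|'C_(G i.+1)[x | to i.+1]%g|%:R *
   #|(phi i hi @^-1: [set phi i hi x])%SET|%:R)) P hT); last first.
  by move=> x; rewrite divr_ge0 // mulr_ge0.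
under eq_bigr => x _ do rewrite hlaw -EFinM.
rewrite sumEFin -EFinM; congr (_%:E).
have G_neq0 j : #|G j|%:R != 0 :> R by rewrite pnatr_eq0 -lt0n cardG_gt0.
pose avg x : R := (#|orbit (to i) (G i) (phi i hi x)|%:R)^-1 /
  #|(phi i hi @^-1: [set phi i hi x])%SET|%:R.
(* The group orders and the orbit count do not depend on [x]; pulled out of the sum, the ratio of
   orders cancels the prefactor of the expectation. *)
rewrite (eq_bigr (fun x => (#|G i|%:R / #|G i.+1|%:R /
    (num_orbits (to i.+1))%:R) * avg x)); last first.
  move=> x _; rewrite /avg !card_stab_orbit !invfM invrK.
  have O_neq0 := card_orbit_neq0 R (to i.+1) x.
  (* The left side holds the orbit size of [x] times its inverse, which [ring] does not cancel; the
     same product is inserted on the right. *)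
  by rewrite -[RHS](mulKf O_neq0); ring.
rewrite -mulr_sumr (sum_fiber_average
  (fun y => (#|orbit (to i) (G i) y|%:R)^-1) (hphi i hi)).
by rewrite sum_orbit_size_inv !mulrA divfK // divff // mul1r mulrC.
Qed.
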